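(* Let $f:\Sigma\to M$ be a differentiable immersion of a connected manifold $\Sigma$ in a Riemannian manifold $M$. Let $\mathcal{A}\subset M$ be an arbitrary subset. Assume that for all $p\in\Sigma$ and $v\in T_p\Sigma$ there exists a vector $\eta\in T_{f(p)}M$ orthogonal to $df_p v$ such that the geodesic $\gamma_\eta:[0,1]\to M$ satisfies $\gamma_\eta(1)\in\mathcal{A}$ and $$L(\gamma_\eta)=d(f(p),\mathcal{A}).$$ Then there is a constant $r\ge 0$ such that $f(\Sigma)$ is contained in $\mathcal{S}(\mathcal{A},r)$.
   Context: $d$ denotes the Riemannian distance on $M$, and for a subset $\mathcal{A}\subset M$ and $r\ge 0$, $\mathcal{S}(\mathcal{A},r)=\{x\in M : d(x,\mathcal{A})=r\}$. $\gamma_\eta:[0,1]\to M$ denotes the geodesic with $\gamma_\eta'(0)=\eta$ (assumed to be defined on $[0,1]$), and $L(\gamma_\eta)$ is its length. The immersion $f$ is only assumed differentiable, not necessarily $C^1$. *)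

(* Defs.v *)
From HB Require Import structures.
From mathcomp Require Import all_boot all_order all_algebra.
From mathcomp Require Import all_classical all_reals all_analysis.
Set Implicit Arguments.
Unset Strict Implicit.
Unset Printing Implicit Defensive.
Import Order.TTheory GRing.Theory Num.Theory.
Import numFieldNormedType.Exports.
Local Open Scope classical_set_scope.
Local Open Scope ring_scope.

Fixpoint Ck_on (R : realType) (n : nat) (V : normedModType R) (k : nat)
    (U : set 'rV[R]_n) (f : 'rV[R]_n -> V) : Prop :=
  if k is k'.+1 then
    (forall x, U x -> differentiable f x) /\
    (forall v, Ck_on k' U (fun x => 'D_v f x))
  else forall x, U x -> {for x, continuous f}.

Definition smooth_on (R : realType) (n : nat) (V : normedModType R)
    (U : set 'rV[R]_n) (f : 'rV[R]_n -> V) : Prop :=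
  forall k, Ck_on k U f.

(* The values of [chart_fun] outside [chart_dom], and of [chart_inv] outside
   the image of [chart_dom], are irrelevant. *)
Record chart (R : realType) (n : nat) (T : topologicalType) := Chart {
  chart_dom : set T;
  chart_fun :> T -> 'rV[R]_n;
  chart_inv : 'rV[R]_n -> T;
  chart_dom_open : open chart_dom;
  chart_img_open : open (chart_fun @` chart_dom);
  chart_funK : forall x, chart_dom x -> chart_inv (chart_fun x) = x;
  chart_fun_continuous : forall x, chart_dom x -> {for x, continuous chart_fun};
  chart_inv_continuous : forall y, (chart_fun @` chart_dom) y ->
    {for y, continuous chart_inv} }.

(* [atlas] need not be maximal.  [chart_at x] is an arbitrarily chosen chart of
   the atlas around [x]; it only serves to name the elements of the tangent
   space at [x] by their coordinates. *)
Record manifold (R : realType) (n : nat) := Manifold {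
  manifold_sort :> topologicalType;
  manifold_hausdorff : hausdorff_space manifold_sort;
  manifold_second_countable : @second_countable manifold_sort;
  atlas : set (chart R n manifold_sort);
  atlas_smooth : forall c c', atlas c -> atlas c' ->
    smooth_on (c @` (chart_dom c `&` chart_dom c')) (c' \o chart_inv c);
  chart_at : manifold_sort -> chart R n manifold_sort;
  chart_at_atlas : forall x, atlas (chart_at x);
  chart_at_dom : forall x, chart_dom (chart_at x) x }.

(* The vector \sum_i v_i d/dx^i at [x] is represented by the row v of its
   components with respect to the coordinates of [chart_at x]. *)
Definition tangent (R : realType) (n : nat) (M : manifold R n) (x : M) : Type :=
  'rV[R]_n.

Section Maps.
Context (R : realType) (m n : nat) (N : manifold R m) (M : manifold R n).

(* The expression of f in the charts chosen at p and at f p. *)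
Definition local_expr (f : N -> M) (p : N) : 'rV[R]_m -> 'rV[R]_n :=
  chart_at (f p) \o f \o chart_inv (chart_at p).

Definition mdifferentiable (f : N -> M) (p : N) : Prop :=
  {for p, continuous f} /\ differentiable (local_expr f p) (chart_at p p).

Definition mdiff (f : N -> M) (p : N) (v : tangent p) : tangent (f p) :=
  'd (local_expr f p) (chart_at p p) v.

(* No continuity of the differential is required. *)
Definition differentiable_immersion (f : N -> M) : Prop :=
  forall p, mdifferentiable f p /\ injective (mdiff f (p := p)).

End Maps.

Section Riemannian.
Context (R : realType) (n : nat) (M : manifold R n).

(* [g x] is the Gram matrix of the inner product of the tangent space at [x] in
   the basis given by [chart_at x].  [local_metric g c y] is the matrix
   (g_ij) of the same inner product, at the point of coordinates [y] in the
   chart [c], in the coordinate basis of [c]. *)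
Definition local_metric (g : M -> 'M[R]_n) (c : chart R n M) (y : 'rV[R]_n) :
    'M[R]_n :=
  let x := chart_inv c y in
  let J := jacobian (chart_at x \o chart_inv c) y in
  J *m g x *m J^T.

Record riemannian_metric := RiemannianMetric {
  metric_mx :> M -> 'M[R]_n;
  metric_sym : forall x, (metric_mx x)^T = metric_mx x;
  metric_pos : forall x (v : 'rV[R]_n), v != 0 ->
    0 < (v *m metric_mx x *m v^T) ord0 ord0;
  metric_smooth : forall c, atlas c ->
    smooth_on (c @` chart_dom c) (local_metric metric_mx c) }.

Variable g : riemannian_metric.

Definition inner (x : M) (u v : tangent x) : R :=
  ((u : 'rV[R]_n) *m g x *m (v : 'rV[R]_n)^T) ord0 ord0.

Definition velocity (gam : R -> M) (t : R) : tangent (gam t) :=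
  derive1 (chart_at (gam t) \o gam) t.

Definition speed (gam : R -> M) (t : R) : R :=
  Num.sqrt (inner (velocity gam t) (velocity gam t)).

Definition curve_length (gam : R -> M) (a b : R) : \bar R :=
  (\int[lebesgue_measure]_(t in `[a, b]%classic) (speed gam t)%:E)%E.

Definition C1_curve_on (I : set R) (gam : R -> M) : Prop :=
  forall t, I t -> {for t, continuous gam} /\
    forall c, atlas c -> chart_dom c (gam t) ->
      derivable (c \o gam) t 1 /\ {for t, continuous (derive1 (c \o gam))}.

(* On each closed piece the curve agrees with a C1 curve defined on an open
   neighbourhood of that piece, so it is C1 up to the end points of the piece,
   one-sidedly. *)
Definition piecewise_C1 (a b : R) (gam : R -> M) : Prop :=
  exists s : seq R, [/\ path <%R a s, last a s = b &
    forall i, (i < size s)%N ->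
      let J := `[nth a (a :: s) i, nth a (a :: s) i.+1]%classic in
      exists (I : set R) (sig : R -> M),
        [/\ open I, J `<=` I, C1_curve_on I sig &
            forall t, J t -> gam t = sig t]].

(* +oo when x and y are not in the same component of M. *)
Definition riem_dist (x y : M) : \bar R :=
  ereal_inf [set l | exists (a b : R) (gam : R -> M),
    [/\ a <= b, piecewise_C1 a b gam, gam a = x, gam b = y &
        l = curve_length gam a b]].

Definition riem_dist_set (x : M) (A : set M) : \bar R :=
  ereal_inf [set riem_dist x y | y in A].

Definition equidistant_set (A : set M) (r : R) : set M :=
  [set x | riem_dist_set x A = r%:E].

Definition christoffel (c : chart R n M) (y : 'rV[R]_n) (k i j : 'I_n) : R :=
  let G := local_metric g c in
  let dG (l p q : 'I_n) := 'D_(delta_mx ord0 l) (fun z => G z p q) y in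
  2^-1 * \sum_l invmx (G y) k l * (dG i j l + dG j i l - dG l i j).

(* I is meant to be open.  The geodesic equation
   x''^k + \sum_(i, j) Gamma^k_ij x'^i x'^j = 0 is required in every chart. *)
Definition geodesic_on (I : set R) (gam : R -> M) : Prop :=
  forall t, I t -> {for t, continuous gam} /\
    forall c, atlas c -> chart_dom c (gam t) ->
      let x := c \o gam in
      [/\ derivable x t 1, derivable (derive1 x) t 1 &
          forall k, derive1n 2 x t ord0 k +
            \sum_i \sum_j christoffel c (x t) k i j *
              derive1 x t ord0 i * derive1 x t ord0 j = 0].

(* gam restricted to [0, 1] is the geodesic with initial vector eta. *)
Definition geodesic01 (x : M) (eta : tangent x) (gam : R -> M) : Prop :=
  [/\ exists I : set R, [/\ open I, `[0, 1]%classic `<=` I & geodesic_on I gam],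
      gam 0 = x &
      derive1 (chart_at x \o gam) 0 = eta].

End Riemannian.

(* Main.v *)
Require Import Defs.
From HB Require Import structures.
From mathcomp Require Import all_boot all_order all_algebra.
From mathcomp Require Import all_classical all_reals all_analysis.
From mathcomp Require Import measurable_realfun ring lra.
Set Implicit Arguments.
Unset Strict Implicit.
Unset Printing Implicit Defensive.
Import Order.TTheory GRing.Theory Num.Theory.
Import numFieldNormedType.Exports.
Local Open Scope classical_set_scope.
Local Open Scope ring_scope.

(* Let h p = d(f p, A); it is continuous, and it equals the length |eta| of the
   minimizing geodesics issued from f p.  Suppose h p > 0 and move from p in the
   direction v.  A competitor for d(f(p + s v), A) is the coordinate segment
   from f(p + s v) to the point of parameter K s of the geodesic orthogonal to
   df_p v, followed by the rest of the geodesic; by Pythagoras it has length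
   h p + O(s / K) as s -> 0+.  So the upper one-sided Dini derivatives of h
   along coordinate lines are nonpositive, in both directions, and h is constant
   near p.  A level set of h of positive value is thus open and closed; if there is
   none, then h = 0.  Where h p = 0 the orthogonality is void, which is why that
   level is not treated directly. *)

(** * Integrals of nonnegative, possibly non-measurable functions *)

Section LowerIntegral.
Local Open Scope ereal_scope.
Context d (T : measurableType d) (R : realType) (mu : {measure set T -> \bar R}).
Import HBNNSimple.

(* [\int] is the supremum over the simple functions below the integrand, so
   the next two lemmas need no measurability of the integrand. *)
Lemma ge0_le_lower_integral (D E : set T) (f g : T -> \bar R) :
  D `<=` E -> (forall x, D x -> 0 <= f x) -> (forall x, E x -> 0 <= g x) ->
  (forall x, D x -> f x <= g x) ->
  \int[mu]_(x in D) f x <= \int[mu]_(x in E) g x.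
Proof.
move=> DE f0 g0 fg; rewrite !ge0_integralE//.
apply: le_ereal_sup => _ [h /= hf <-]; exists h => //= x.
apply: le_trans (hf x) _; rewrite /patch.
case: ifPn => [/set_mem Dx|_]; first by rewrite mem_set; [exact: fg|exact: DE].
by case: ifPn => // /set_mem /g0.
Qed.

Lemma ge0_lower_integral_setU (A B : set T) (f : T -> \bar R) :
  measurable A -> measurable B -> [disjoint A & B] ->
  (forall x, 0 <= f x) ->
  \int[mu]_(x in A `|` B) f x <=
    \int[mu]_(x in A) f x + \int[mu]_(x in B) f x.
Proof.
move=> mA mB AB f0; rewrite ge0_integralE//.
apply: ge_ereal_sup => _ [h /= hf <-].
(* The nonnegative simple function [h] lies below an integrand cut off outside [A] and [B], so it
   vanishes there. Additivity is then applied to [h], which is measurable. *)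
have hAB : h \_ (A `|` B) = h :> (T -> R).
  apply/funext => x; rewrite /patch; case: ifPn => // xAB.
  apply/esym/eqP; rewrite eq_le fun_ge0 andbT.
  by have := hf x; rewrite /patch (negbTE xAB) lee_fin.
have hle x : (A `|` B) x -> (h x)%:E <= f x.
  by move=> xAB; have := hf x; rewrite /patch mem_set.
have -> : sintegral mu h = \int[mu]_(x in A `|` B) (h x)%:E.
  by rewrite integral_nnsfun ?hAB//; exact: measurableU.
rewrite ge0_integral_setU//; last first.
- by move=> x _; rewrite lee_fin fun_ge0.
- exact/measurable_EFinP/measurable_funTS.
apply: leeD; apply: ge0_le_lower_integral => //.
- by move=> x _; rewrite lee_fin fun_ge0.
- by move=> x xA; apply: hle; left.
- by move=> x _; rewrite lee_fin fun_ge0.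
- by move=> x xA; apply: hle; right.
Qed.

End LowerIntegral.

(** The point [c] is a null set. Leaving it out on the right disposes of the speed at the junction
    of two curves, which is uncontrolled. *)
Lemma ge0_lower_integral_itv_split (R : realType) (a b c : R) (f : R -> \bar R) :
  a <= c <= b -> (forall t, 0 <= f t)%E ->
  (\int[lebesgue_measure]_(t in `[a, b]) f t <=
   \int[lebesgue_measure]_(t in `[a, c[) f t +
   \int[lebesgue_measure]_(t in `]c, b]) f t)%E.
Proof.
move=> /andP[ac cb] f0.
have -> : `[a, b]%classic = `[a, c[ `|` ([set c] `|` `]c, b]).
  apply/seteqP; split => t /=; rewrite !in_itv/=.
    move=> /andP[at_ tb]; case: (ltgtP t c) => tc; [left|right; right|right; left].
    - by rewrite at_.
    - by [].
    - by [].
  move=> [/andP[-> /ltW/le_trans->]//|[->|/andP[/ltW ct ->]]].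
    by rewrite ac cb.
  by rewrite (le_trans ac).
apply: (le_trans (ge0_lower_integral_setU _ _ _ _ _)) => //.
- exact: measurableU.
- apply/disj_setPS => t [/=]; rewrite !in_itv/= => /andP[_ tc] [tc'|/andP[ct _]].
    by move: tc; rewrite tc' ltxx.
  by have := lt_trans tc ct; rewrite ltxx.
apply: leeD => //.
apply: (le_trans (ge0_lower_integral_setU _ _ _ _ _)) => //.
- by apply/disj_setPS => t [/= ->]; rewrite in_itv/= ltxx.
- by rewrite integral_set1 add0e.
Qed.

(** * Calculus in charts *)

Lemma derive1_comp_vec (R : realType) (U V : normedModType R) (x : R -> U)
    (h : U -> V) (t : R) :
  derivable x t 1 -> differentiable h (x t) ->
  derivable (h \o x) t 1 /\ derive1 (h \o x) t = 'D_(derive1 x t) h (x t).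
Proof.
move=> /derivable1_diffP dx dh; split.
  exact/derivable1_diffP/differentiable_comp.
rewrite derive1E'; last exact: differentiable_comp.
by rewrite diff_comp// derive1E' // deriveE.
Qed.

Lemma near_eq_derive1 (R : realType) (V : normedModType R) (u w : R -> V)
    (t : R) :
  (\forall s \near t, u s = w s) -> derivable u t 1 ->
  derivable w t 1 /\ derive1 w t = derive1 u t.
Proof.
move=> uw du; split; first exact: near_eq_derivable du.
by rewrite !derive1E; apply/esym/near_eq_derive.
Qed.

Section Charts.
Context (R : realType) (n : nat) (T : topologicalType) (c : chart R n T).

Lemma chart_invK y : (c @` chart_dom c) y -> c (chart_inv c y) = y.
Proof. by move=> [x cx <-]; rewrite chart_funK. Qed.

Lemma chart_inv_dom y : (c @` chart_dom c) y -> chart_dom c (chart_inv c y).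
Proof. by move=> [x cx <-]; rewrite chart_funK. Qed.

Lemma chart_img_nbhs x : chart_dom c x -> nbhs (c x) (c @` chart_dom c).
Proof.
move=> cx; apply: open_nbhs_nbhs; split; last by exists x.
exact: chart_img_open.
Qed.

Lemma chart_dom_nbhs x : chart_dom c x -> nbhs x (chart_dom c).
Proof.
by move=> cx; apply: open_nbhs_nbhs; split => //; exact: chart_dom_open.
Qed.

Lemma chart_inv_cvg x : chart_dom c x -> chart_inv c y @[y --> c x] --> x.
Proof.
move=> cx; rewrite -{2}(chart_funK cx).
by apply: chart_inv_continuous; exists x.
Qed.

End Charts.

Section Manifolds.
Context (R : realType) (n : nat) (M : manifold R n).
Implicit Types (c : chart R n M) (x : M).

Lemma transition_differentiable c c' x : atlas c -> atlas c' ->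
  chart_dom c x -> chart_dom c' x -> differentiable (c' \o chart_inv c) (c x).
Proof.
move=> ac ac' cx cx'; have [+ _] := atlas_smooth ac ac' 1.
by apply; exists x.
Qed.

Lemma transition_derive_continuous c c' x v : atlas c -> atlas c' ->
  chart_dom c x -> chart_dom c' x ->
  {for c x, continuous (fun y => 'D_v (c' \o chart_inv c) y)}.
Proof.
move=> ac ac' cx cx'; have [_ /(_ v) +] := atlas_smooth ac ac' 1.
by apply; exists x.
Qed.

Lemma change_chart c c' (gam : R -> M) t : atlas c -> atlas c' ->
  {for t, continuous gam} -> chart_dom c (gam t) -> chart_dom c' (gam t) ->
  derivable (c \o gam) t 1 ->
  derivable (c' \o gam) t 1 /\ derive1 (c' \o gam) t =
    derive1 (c \o gam) t *m jacobian (c' \o chart_inv c) (c (gam t)).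
Proof.
move=> ac ac' gamc ct ct' dg.
have dT := transition_differentiable ac ac' ct ct'.
have [d1 e1] := derive1_comp_vec dg dT.
have eqn : \forall s \near t, ((c' \o chart_inv c) \o (c \o gam)) s = (c' \o gam) s.
  have gd : \forall s \near t, chart_dom c (gam s) := gamc _ (chart_dom_nbhs ct).
  by apply: filterS gd => s cs /=; rewrite chart_funK.
have [d2 e2] := near_eq_derive1 eqn d1; split => //.
by rewrite e2 e1 deriveEjacobian.
Qed.

(** Near [c x] the two transition maps compose to the identity, and the chain rule in each basis
    direction gives one row of the product. This is what makes the metric nondegenerate in every
    chart. *)
Lemma transition_jacobianK c c' x : atlas c -> atlas c' ->
  chart_dom c x -> chart_dom c' x ->
  jacobian (c' \o chart_inv c) (c x) *m jacobian (c \o chart_inv c') (c' x)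
    = 1%:M.
Proof.
move=> ac ac' cx cx'; apply/row_matrixP => i.
rewrite row_mul row1 rowE -mulmxA.
have dT := transition_differentiable ac ac' cx cx'.
have dT' := transition_differentiable ac' ac cx' cx.
have eT : (c' \o chart_inv c) (c x) = c' x by rewrite /= chart_funK.
have dT2 : differentiable (c \o chart_inv c') ((c' \o chart_inv c) (c x)).
  by rewrite eT.
rewrite mulmxA -!deriveEjacobian// !deriveE// -[in LHS]eT.
rewrite -[LHS]/(('d (c \o chart_inv c') ((c' \o chart_inv c) (c x)) \o
   'd (c' \o chart_inv c) (c x)) (delta_mx 0 i)).
rewrite -diff_comp// -deriveE; last exact: differentiable_comp.
rewrite -[RHS](@derive_id _ _ (c x) (delta_mx 0 i)).
apply: near_eq_derive.
have nd : \forall y \near c x, chart_dom c' (chart_inv c y).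
  exact: (chart_inv_cvg cx) (chart_dom_nbhs cx').
near=> y; rewrite /= chart_funK; last by near: y.
by rewrite chart_invK//; near: y; exact: chart_img_nbhs.
Unshelve. all: by end_near. Qed.

End Manifolds.

(** * The Riemannian metric in charts *)

Definition quad (R : realType) (n : nat) (G : 'M[R]_n) (u : 'rV[R]_n) : R :=
  (u *m G *m u^T) ord0 ord0.

Section Metric.
Context (R : realType) (n : nat) (M : manifold R n) (g : riemannian_metric M).
Implicit Types (c : chart R n M) (x : M).

Lemma local_metric_sym c y : (local_metric g c y)^T = local_metric g c y.
Proof. by rewrite /local_metric !trmx_mul trmxK Defs.metric_sym mulmxA. Qed.

Lemma quad_metric_ge0 x (u : 'rV[R]_n) : 0 <= quad (g x) u.
Proof.
have [->|u0] := eqVneq u 0; first by rewrite /quad !mul0mx mxE.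
exact/ltW/metric_pos.
Qed.

Lemma quad_local_metric c y (u : 'rV[R]_n) :
  let x := chart_inv c y in
  quad (local_metric g c y) u
  = quad (g x) (u *m jacobian (chart_at x \o chart_inv c) y).
Proof. by rewrite /quad /local_metric trmx_mul !mulmxA. Qed.

(** The Jacobian has a right inverse, so it sends no nonzero row to 0, and [metric_pos] applies to
    the image. *)
Lemma quad_local_metric_gt0 c x (u : 'rV[R]_n) : atlas c -> chart_dom c x ->
  u != 0 -> 0 < quad (local_metric g c (c x)) u.
Proof.
move=> ac cx u0; rewrite quad_local_metric chart_funK//.
apply: metric_pos; apply: contra_neq u0 => uJ.
rewrite -[u]mulmx1.
rewrite -(transition_jacobianK ac (chart_at_atlas x) cx (chart_at_dom x)).
by rewrite mulmxA uJ mul0mx.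
Qed.

(** A nonzero row in the kernel would have square length 0, against positive definiteness. *)
Lemma local_metric_unit c x : atlas c -> chart_dom c x ->
  local_metric g c (c x) \in unitmx.
Proof.
move=> ac cx; rewrite -row_free_unit -kermx_eq0; apply/eqP/row_matrixP => i.
rewrite row0; apply/eqP/contraT => /(quad_local_metric_gt0 ac cx).
by rewrite /quad -row_mul mulmx_ker row0 mul0mx mxE ltxx.
Qed.

Lemma local_metric_chart_at x :
  local_metric g (chart_at x) (chart_at x x) = g x.
Proof.
have cx := chart_at_dom x; have ax := chart_at_atlas x.
rewrite /local_metric chart_funK//.
suff -> : jacobian (chart_at x \o chart_inv (chart_at x)) (chart_at x x) = 1%:M.
  by rewrite trmx1 mulmx1 mul1mx.
apply/row_matrixP => i; rewrite row1 rowE -deriveEjacobian; last first.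
  exact: transition_differentiable.
rewrite -[RHS](@derive_id _ _ (chart_at x x) (delta_mx 0 i)).
apply: near_eq_derive; apply: filterS (chart_img_nbhs cx) => y.
exact: chart_invK.
Qed.

(** [speed] refers to the chart chosen at [gam t], and that choice may vary arbitrarily with [t].
    Here one chart can be kept along the curve. *)
Lemma speedE c (gam : R -> M) t : atlas c ->
  {for t, continuous gam} -> chart_dom c (gam t) -> derivable (c \o gam) t 1 ->
  speed g gam t =
  Num.sqrt (quad (local_metric g c (c (gam t))) (derive1 (c \o gam) t)).
Proof.
move=> ac gamc ct dg; rewrite /speed; congr Num.sqrt.
have [_ e] := change_chart ac (chart_at_atlas (gam t)) gamc ct
  (chart_at_dom _) dg.
by rewrite quad_local_metric chart_funK// -e.
Qed.

End Metric.

(** * Geodesics have constant speed *)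

Lemma quadE (R : realType) (n : nat) (G : 'M[R]_n) (u : 'rV[R]_n) :
  quad G u = \sum_i \sum_j u 0 i * (G i j * u 0 j).
Proof.
rewrite /quad -mulmxA mxE; apply: eq_bigr => i _.
by rewrite mxE mulr_sumr; apply: eq_bigr => j _; rewrite mxE.
Qed.

Lemma derive_row_sum (R : realType) (n : nat) (V : normedModType R)
    (h : 'rV[R]_n -> V) (y v : 'rV[R]_n) :
  differentiable h y ->
  'D_v h y = \sum_l v 0 l *: 'D_(delta_mx ord0 l) h y.
Proof.
move=> dh; rewrite deriveE// [in LHS](row_sum_delta v) linear_sum.
by apply: eq_bigr => l _; rewrite linearZ deriveE.
Qed.

(** The product rule for the squared speed, in the shape that [christoffel_metric] shows to vanish
    along geodesics. *)
Lemma is_derive_quad (R : realType) (n : nat) (G : 'rV[R]_n -> 'M[R]_n)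
    (x : R -> 'rV[R]_n) (t : R) :
  derivable x t 1 -> derivable (derive1 x) t 1 -> differentiable G (x t) ->
  let a := derive1 x t in let b := derive1 (derive1 x) t in
  is_derive t 1 (fun s => quad (G (x s)) (derive1 x s))
    (\sum_i \sum_j (b 0 i * (G (x t) i j * a 0 j)
      + a 0 i * ((\sum_l a 0 l *
          'D_(delta_mx ord0 l) (fun z => G z i j) (x t)) * a 0 j)
      + a 0 i * (G (x t) i j * b 0 j))).
Proof.
move=> dx ddx dG a b.
have -> : (fun s => quad (G (x s)) (derive1 x s)) =
    \sum_i \sum_j ((fun s => derive1 x s 0 i) *
      ((fun s => G (x s) i j) * (fun s => derive1 x s 0 j))).
  apply/funext => s; rewrite quadE fct_sumE; apply: eq_bigr => i _.
  by rewrite fct_sumE.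
have da i : is_derive t 1 (fun s => derive1 x s 0 i) (b 0 i).
  apply: DeriveDef; first by move/derivable_mxP : ddx; apply.
  by rewrite /b derive1E (derive_mx ddx) mxE.
have dGij i j : is_derive t 1 (fun s => G (x s) i j)
    (\sum_l a 0 l * 'D_(delta_mx ord0 l) (fun z => G z i j) (x t)).
  have dGe : differentiable (fun z => G z i j) (x t).
    exact: (differentiable_comp dG (differentiable_coord (G (x t)) i j)).
  have [d e] := derive1_comp_vec dx dGe.
  apply: DeriveDef => //.
  by move: e; rewrite derive1E => ->; rewrite derive_row_sum.
pose h i j : R -> R := (fun s => derive1 x s 0 i) *
  ((fun s => G (x s) i j) * (fun s => derive1 x s 0 j)).
pose dh i j := b 0 i * (G (x t) i j * a 0 j)
  + a 0 i * ((\sum_l a 0 l *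
      'D_(delta_mx ord0 l) (fun z => G z i j) (x t)) * a 0 j)
  + a 0 i * (G (x t) i j * b 0 j).
have dhij i j : is_derive t 1 (h i j) (dh i j).
  by apply: is_derive_eq; rewrite /dh /= /GRing.scale /= -/a mulrfctE; ring.
exact: (is_derive_sum (fun i => is_derive_sum (dhij i))).
Qed.

Section GeodesicSpeed.
Context (R : realType) (n : nat) (M : manifold R n) (g : riemannian_metric M).

(* The Christoffel symbols are those of a connection compatible with [g]. *)
Lemma christoffel_metric (c : chart R n M) (y a b : 'rV[R]_n) :
  let G := local_metric g c in
  G y \in unitmx ->
  (forall k, b ord0 k + \sum_i \sum_j christoffel g c y k i j *
     a ord0 i * a ord0 j = 0) ->
  \sum_i \sum_j (b 0 i * (G y i j * a 0 j)
      + a 0 i * ((\sum_l a 0 l *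
          'D_(delta_mx ord0 l) (fun z => G z i j) y) * a 0 j)
      + a 0 i * (G y i j * b 0 j)) = 0.
Proof.
move=> G Gu hb.
pose dG l p q := 'D_(delta_mx ord0 l) (fun z => G z p q) y.
pose T := \sum_i \sum_j a 0 i * ((\sum_l a 0 l * dG l i j) * a 0 j).
(* [W] is twice the Christoffel symbols of the first kind, contracted with [a] in two indices. The
   geodesic equation then reads [G b^T = - W^T / 2]. *)
pose W := \row_l \sum_i \sum_j (dG i j l + dG j i l - dG l i j) * (a 0 i * a 0 j).
have bE : b^T = (- 2^-1) *: (invmx (G y) *m W^T).
  apply/matrixP => k j; rewrite [j]ord1 !mxE.
  have /eqP := hb k; rewrite addr_eq0 => /eqP ->.
  rewrite mulNr; congr (- _); rewrite mulr_sumr.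
  under eq_bigr do (under eq_bigr do rewrite /christoffel -mulrA -mulrA mulr_suml).
  under [RHS]eq_bigr do rewrite !mxE mulr_sumr mulr_sumr.
  rewrite [RHS]exchange_big/=; apply: eq_bigr => i _.
  under [RHS]eq_bigr do rewrite mulr_sumr mulr_sumr.
  rewrite [RHS]exchange_big/=; apply: eq_bigr => j' _.
  rewrite mulr_sumr; apply: eq_bigr => l _.
  by rewrite /dG /G; ring.
have GbE : G y *m b^T = (- 2^-1) *: W^T.
  by rewrite bE -scalemxAr mulmxA mulmxV// mul1mx.
(* Contracted once more with [a], each of the three terms of [W] becomes [T] after renaming the
   indices; with the signs +, +, - one [T] is left. *)
have aW : \sum_l a 0 l * W 0 l = T.
  rewrite /T.
  have E (F : 'I_n -> 'I_n -> 'I_n -> R) :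
    \sum_i \sum_j \sum_k F i j k = \sum_i \sum_j \sum_k F k i j.
    by rewrite exchange_big; apply: eq_bigr => j _; rewrite exchange_big.
  pose F i j k := a 0 i * a 0 j * a 0 k * dG k i j.
  have -> : \sum_i \sum_j a 0 i * ((\sum_l a 0 l * dG l i j) * a 0 j) =
     \sum_i \sum_j \sum_k F i j k.
    apply: eq_bigr => i _; apply: eq_bigr => j _.
    by rewrite mulr_suml mulr_sumr; apply: eq_bigr => k _; rewrite /F; ring.
  have -> : \sum_l a 0 l * W 0 l =
      \sum_l \sum_i \sum_j (F j l i + F i l j - F i j l).
    apply: eq_bigr => l _; rewrite mxE mulr_sumr; apply: eq_bigr => i _.
    by rewrite mulr_sumr; apply: eq_bigr => j _; rewrite /F; ring.
  under eq_bigr => l do under eq_bigr => i do rewrite sumrB big_split/=.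
  under eq_bigr => l do rewrite sumrB big_split/=.
  rewrite sumrB big_split/= -(E F) -(E (fun i j k => F k i j)) -(E F).
  by rewrite [X in _ + X - _]exchange_big/= addrK.
(* Each of the two terms containing [b] equals [- T / 2]; together they cancel the term [T] coming
   from the derivative of the metric. *)
have aGb : \sum_i \sum_j a 0 i * (G y i j * b 0 j) = - 2^-1 * T.
  rewrite -aW mulr_sumr; apply: eq_bigr => i _.
  have /matrixP/(_ i ord0) := GbE; rewrite !mxE => GbEi.
  rewrite mulrCA -GbEi mulr_sumr; apply: eq_bigr => j _.
  by rewrite !mxE.
have bGa : \sum_i \sum_j b 0 i * (G y i j * a 0 j) = - 2^-1 * T.
  rewrite -aGb exchange_big; apply: eq_bigr => i _; apply: eq_bigr => j _.
  have -> : G y j i = G y i j by rewrite /G -[in LHS](local_metric_sym g c y) mxE.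
  by ring.
under eq_bigr do rewrite !big_split/=.
rewrite !big_split/= aGb bGa.
rewrite -/T.
by field.
Qed.

Lemma geodesic_speed_cst (I : set R) (gam : R -> M) :
  open I -> `[0, 1] `<=` I -> geodesic_on g I gam ->
  forall t, 0 <= t <= 1 -> speed g gam t = speed g gam 0.
Proof.
move=> oI I01 geo t /andP[t0 t1].
pose Q s := inner g (velocity gam s) (velocity gam s).
suff QE s : s \in `[0, t] -> is_derive s 1 Q 0.
  have Qc : {within `[0, t], continuous Q}.
    by apply: derivable_within_continuous => s /QE[].
  have dQ s : s \in `]0, t[ -> is_derive s 1 Q ((fun=> 0) s).
    by move=> /subset_itv_oo_cc /QE.
  have [c _] := MVT_segment t0 dQ Qc.
  by rewrite mul0r /speed => /subr0_eq; rewrite /Q => ->.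
move=> st; have Is : I s.
  by apply: I01; move: st; rewrite /= !in_itv/= => /andP[-> /le_trans->].
pose c := chart_at (gam s).
have ac : atlas c := chart_at_atlas _.
have cs : chart_dom c (gam s) := chart_at_dom _.
have [gs /(_ c ac cs)[dx ddx eqx]] := geo s Is.
have dG : differentiable (local_metric g c) ((c \o gam) s).
  by have [+ _] := metric_smooth g ac 1; apply; exists (gam s).
have Gu : local_metric g c ((c \o gam) s) \in unitmx by exact: local_metric_unit.
(* The derivative is computed in the chart [c] fixed at [gam s]. [Q] uses a chart that depends on
   the point, but has the same values near [s]. *)
have := is_derive_eq (is_derive_quad dx ddx dG) (christoffel_metric Gu eqx).
apply: near_eq_is_derive.
have nI : \forall r \near s, I r by apply: open_nbhs_nbhs.
have nc : \forall r \near s, chart_dom c (gam r) := gs _ (chart_dom_nbhs cs).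
near=> r.
have Ir : I r by near: r.
have cr : chart_dom c (gam r) by near: r.
have [gr /(_ c ac cr)[dxr _ _]] := geo r Ir.
have [_ e] := change_chart ac (chart_at_atlas (gam r)) gr cr (chart_at_dom _) dxr.
by rewrite quad_local_metric /= chart_funK// /Q /velocity e.
Unshelve. all: by end_near. Qed.

End GeodesicSpeed.

(** * Lengths of curves and the distance to a set *)

Section Curves.
Context (R : realType) (n : nat) (M : manifold R n) (g : riemannian_metric M).
Implicit Types (gam sig : R -> M) (A : set M).

Lemma speed_ge0 gam t : 0 <= speed g gam t.
Proof. exact: sqrtr_ge0. Qed.

Lemma curve_length_ge0 gam a b : (0 <= curve_length g gam a b)%E.
Proof. by apply: integral_ge0 => t _; rewrite lee_fin speed_ge0. Qed.

Lemma riem_dist_set_ge0 x A : (0 <= riem_dist_set g x A)%E.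
Proof.
apply: le_ereal_inf_tmp => _ [y _ <-]; apply: le_ereal_inf_tmp.
by move=> _ [a [b [gam [_ _ _ _ ->]]]]; exact: curve_length_ge0.
Qed.

Lemma riem_dist_set_le_length A gam a b : a <= b -> piecewise_C1 a b gam ->
  A (gam b) -> (riem_dist_set g (gam a) A <= curve_length g gam a b)%E.
Proof.
move=> ab pw Ab; apply: (@le_trans _ _ (riem_dist g (gam a) (gam b))).
  by apply: ereal_inf_lbound; exists (gam b).
by apply: ereal_inf_lbound; exists a, b, gam.
Qed.

Lemma near_eq_speed gam sig t : (\forall s \near t, gam s = sig s) ->
  speed g gam t = speed g sig t.
Proof.
move=> e; rewrite /speed /inner /velocity (nbhs_singleton e) !derive1E.
suff -> : 'D_1 (chart_at (sig t) \o gam) t = 'D_1 (chart_at (sig t) \o sig) t.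
  by [].
by apply: near_eq_derive; apply: filterS e => s /= ->.
Qed.

Lemma C1_curve_piecewise (I : set R) gam a b : open I -> `[a, b] `<=` I ->
  C1_curve_on I gam -> a <= b -> piecewise_C1 a b gam.
Proof.
move=> oI abI C1; rewrite le_eqVlt => /predU1P[->|ab].
  by exists [::]; split.
exists [:: b]; split => //; first by rewrite /= ab.
by move=> [|//] _ /=; exists I, gam.
Qed.

Lemma geodesic_C1 (I : set R) gam : geodesic_on g I gam -> C1_curve_on I gam.
Proof.
move=> geo t /geo[gamt h]; split; first exact: gamt.
move=> c ac ct; have [d dd _] := h c ac ct; split; first exact: d.
exact/differentiable_continuous/derivable1_diffP.
Qed.

Lemma curve_length_cst gam a b k : a <= b ->
  (forall t, t \in `[a, b] -> speed g gam t = k) ->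
  curve_length g gam a b = ((b - a) * k)%:E.
Proof.
move=> ab spk; rewrite /curve_length.
rewrite (eq_integral (cst k%:E)); last first.
  by move=> t /set_mem /= tab; rewrite spk.
rewrite integral_cst//= lebesgue_measure_itv/= lte_fin.
case: ltP => [_|ba]; first by rewrite -EFinD -EFinM mulrC.
have -> : b = a by apply/eqP; rewrite eq_le ab ba.
by rewrite subrr mul0r mule0.
Qed.

(** The added piece runs over a parameter interval of length 1, so a bound on its speed is also a
    bound on its length. The speed of [gam'] is identified with that of [sig] or [gam] only away
    from [a], the point that the split integral omits. *)
Lemma curve_length_prepend gam sig a b B : a <= b ->
  let gam' t := if t <= a then sig t else gam t in
  (forall t, t \in `[a - 1, a[ -> speed g sig t <= B) ->
  (curve_length g gam' (a - 1) b <= B%:E + curve_length g gam a b)%E.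
Proof.
move=> ab gam' spB.
have a1 : a - 1 <= a <= b by rewrite ab andbT gerBl.
apply: (le_trans (ge0_lower_integral_itv_split a1 _)).
  by move=> t; rewrite lee_fin speed_ge0.
have speed_sig t : t < a -> speed g gam' t = speed g sig t.
  move=> ta; apply: near_eq_speed; near=> s.
  by rewrite /gam' ifT//; near: s; exact: lt_le_nbhsl.
have speed_gam t : a < t -> speed g gam' t = speed g gam t.
  move=> ta; apply: near_eq_speed; near=> s.
  rewrite /gam' leNgt ifF//; apply/negbTE; rewrite negbK.
  by near: s; exact: lt_nbhsr.
apply: leeD.
  have -> : B%:E = (\int[lebesgue_measure]_(t in `[(a - 1)%R, a[) (cst B%:E t))%E.
    rewrite integral_cst//= lebesgue_measure_itv/= lte_fin ltrBlDr ltrDl ltr01.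
    by rewrite -EFinD opprB addrC subrK mule1.
  have B0 : 0 <= B.
    apply: (le_trans (speed_ge0 sig (a - 1)) (spB _ _)).
    by rewrite in_itv/= lexx ltrBlDr ltrDl ltr01.
  apply: ge0_le_lower_integral; first exact: subset_refl.
  - by move=> t _; rewrite lee_fin speed_ge0.
  - by move=> t _; rewrite lee_fin.
  - move=> t ta; rewrite lee_fin speed_sig ?spB//.
    by move: ta; rewrite /= in_itv/= => /andP[].
apply: ge0_le_lower_integral.
- by move=> t; rewrite /= !in_itv/= => /andP[/ltW-> ->].
- by move=> t _; rewrite lee_fin speed_ge0.
- by move=> t _; rewrite lee_fin speed_ge0.
- by move=> t; rewrite /= in_itv/= => /andP[/speed_gam-> _].
Unshelve. all: by end_near. Qed.

Lemma piecewise_C1_prepend (I : set R) gam sig a b : open I ->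
  `[a - 1, a] `<=` I -> C1_curve_on I sig -> sig a = gam a ->
  piecewise_C1 a b gam ->
  piecewise_C1 (a - 1) b (fun t => if t <= a then sig t else gam t).
Proof.
move=> oI aI C1 sga [s [ps ls hs]]; exists (a :: s); split => //=.
  by rewrite ltrBlDr ltrDl ltr01.
move=> [_|i si]/=.
  by exists I, sig; split => // t; rewrite /= in_itv/= => /andP[_ ->].
(* The default of [nth] is [a - 1] in the goal and [a] in the hypothesis on [gam]; the indices are
   within range, so either will do. *)
rewrite (set_nth_default a) 1?ltnW// (set_nth_default a)//.
have [I' [sig' [oI' JI' C1' e]]] := hs i si; exists I', sig'; split => // t Jt.
rewrite -e//; case: ifPn => // ta.
(* The pieces of [gam] start at or after [a], so they meet the branch of [sig] only at [a], where
   both curves agree. *)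
suff -> : t = a by [].
apply/eqP; rewrite eq_le ta/=.
move: Jt; rewrite /= in_itv/= => /andP[+ _]; apply: le_trans.
clear JI' e; case: i si => [//|i si] /=.
have /(all_nthP a) := order_path_min (@lt_trans _ _) ps.
by move=> /(_ i (ltnW si)) /ltW.
Qed.

End Curves.

Lemma near_eq_continuous (T U : topologicalType) (f h : T -> U) (t : T) :
  {near t, f =1 h} -> {for t, continuous f} -> {for t, continuous h}.
Proof.
move=> fh; rewrite /prop_for /continuous_at -(nbhs_singleton fh).
exact: cvg_trans (near_eq_cvg fh).
Qed.

(** * Coordinate segments *)

Section Line.
Context (R : realType) (V : normedModType R).
Implicit Types (a t : R) (z v : V).

(** The offset [a] lets a segment arrive at [z] at the initial parameter of the curve that it is
    prepended to. With [a = 0] the line leaves from [z]. *)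
Definition line a z v t : V := z + (t - a) *: v.

Lemma is_derive_line a z v t : is_derive t 1 (line a z v) v.
Proof.
have d : is_derive t (1 : R) (fun s : R => s - a) 1.
  by apply: is_derive_eq; rewrite subr0.
have [dl el] := derive1_comp_vec (h := fun k : R => k *: v)
  (@ex_derive _ _ _ _ _ _ _ d) (@ex_diff _ _ _ _ _ _ _ (is_diff_scalel _ _)).
rewrite -[X in is_derive _ _ _ X]add0r.
apply: (is_deriveD (f := cst z) (g := (fun k : R => k *: v) \o (fun s => s - a))).
apply: DeriveDef => //; rewrite -derive1E el deriveE// diff_val.
by rewrite derive1E derive_val scale1r.
Qed.

Lemma line_continuous a z v : continuous (line a z v).
Proof.
move=> t; apply/differentiable_continuous/derivable1_diffP.
by have [] := is_derive_line a z v t.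
Qed.

End Line.

Section Segments.
Context (R : realType) (n : nat) (M : manifold R n) (g : riemannian_metric M).

(** In [c] the velocity is the constant [v]. In another chart it is the derivative of the transition
    map along [v], continuous because transition maps are C1. *)
Lemma segment_C1 (c : chart R n M) (U : set 'rV[R]_n) a z v : atlas c ->
  open U -> U `<=` c @` chart_dom c ->
  let sig := chart_inv c \o line a z v in
  [/\ open (line a z v @^-1` U), C1_curve_on (line a z v @^-1` U) sig &
    forall t, U (line a z v t) ->
      speed g sig t = Num.sqrt (quad (local_metric g c (line a z v t)) v)].
Proof.
move=> ac oU Uc sig.
have oI : open (line a z v @^-1` U).
  by apply: open_comp => // t _; exact: line_continuous.
have sigc t : U (line a z v t) -> {for t, continuous sig}.
  move=> Ut; apply: continuous_comp; first exact: line_continuous.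
  exact: chart_inv_continuous (Uc _ Ut).
have dsig t : U (line a z v t) ->
    derivable (c \o sig) t 1 /\ derive1 (c \o sig) t = v.
  move=> Ut; have [d e] := is_derive_line a z v t.
  rewrite -[X in _ = X]e -derive1E; apply: near_eq_derive1 d.
  have : nbhs t (line a z v @^-1` U) by apply: open_nbhs_nbhs.
  by apply: filterS => s Us; rewrite /sig /= chart_invK//; exact: Uc.
have csig t : U (line a z v t) -> chart_dom c (sig t).
  by move=> Ut; apply: chart_inv_dom; exact: Uc.
split=> // [t Ut|t Ut].
  split; first exact: sigc.
  move=> c' ac' ct'.
  have D s : U (line a z v s) -> chart_dom c' (sig s) ->
      derivable (c' \o sig) s 1 /\
      derive1 (c' \o sig) s = 'D_v (c' \o chart_inv c) (line a z v s).
    move=> Us cs'; have [d e] := dsig s Us.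
    have [d' ->] := change_chart ac ac' (sigc s Us) (csig s Us) cs' d.
    have := transition_differentiable ac ac' (csig s Us) cs'.
    rewrite e /sig /= chart_invK; last exact: Uc.
    by move=> dT; split => //; rewrite deriveEjacobian.
  have [d e] := D t Ut ct'; split; first exact: d.
  have cD : {for t, continuous (fun s => 'D_v (c' \o chart_inv c) (line a z v s))}.
    apply: (@continuous_comp _ _ _ (line a z v)
      (fun y => 'D_v (c' \o chart_inv c) y)).
      exact: line_continuous.
    have := @transition_derive_continuous _ _ _ _ _ _ v ac ac' (csig t Ut) ct'.
    by rewrite /sig /= chart_invK//; exact: Uc.
  have ne : {near t, (fun s => 'D_v (c' \o chart_inv c) (line a z v s)) =1
      derive1 (c' \o sig)}.
    have nU : nbhs t (line a z v @^-1` U) by apply: open_nbhs_nbhs.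
    have nc : \forall s \near t, chart_dom c' (sig s) :=
      sigc t Ut _ (chart_dom_nbhs ct').
    by near=> s; apply/esym; apply (D s); near: s.
  exact: near_eq_continuous ne cD.
have [d e] := dsig t Ut.
rewrite (speedE g ac (sigc t Ut) (csig t Ut) d) e.
by rewrite /sig /= chart_invK//; exact: Uc.
Unshelve. all: by end_near. Qed.

Lemma ball_segment (V : normedModType R) (x y z : V) (r l : R) :
  ball x r y -> ball x r z -> 0 <= l <= 1 -> ball x r (z + (l - 1) *: (z - y)).
Proof.
rewrite -!ball_normE /= => xy xz /andP[l0 l1].
have -> : x - (z + (l - 1) *: (z - y)) = (1 - l) *: (x - y) + l *: (x - z).
  have -> : z + (l - 1) *: (z - y) = (1 - l) *: y + l *: z.
    rewrite scalerBr scalerBl scale1r addrA [z + _]addrC subrK addrC.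
    by rewrite -scaleNr opprB.
  by rewrite !scalerBr addrACA -scalerDl subrK scale1r -opprD.
apply: (le_lt_trans (ler_normD _ _)); rewrite !normrZ.
rewrite (ger0_norm l0) ger0_norm ?subr_ge0//.
have [->|lneq0] := eqVneq l 0; first by rewrite subr0 mul1r mul0r addr0.
have lp : 0 < l by rewrite lt_neqAle eq_sym lneq0.
nra.
Qed.

(** Every curve from [chart_inv c z] to [A] is preceded by the coordinate segment from [y] to [z],
    run in unit time with speed at most [B]. Balls are convex, so the segment stays where the metric
    is bounded. *)
Lemma riem_dist_set_segment (c : chart R n M) (x y z : 'rV[R]_n) (r B : R) A :
  atlas c -> ball x r `<=` c @` chart_dom c -> ball x r y -> ball x r z ->
  0 <= B ->
  (forall w, ball x r w -> quad (local_metric g c w) (z - y) <= B ^+ 2) ->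
  (riem_dist_set g (chart_inv c y) A <=
    B%:E + riem_dist_set g (chart_inv c z) A)%E.
Proof.
move=> ac bc xy xz B0 qB.
rewrite -leeBlDl//; apply: le_ereal_inf_tmp => _ [p Ap <-].
apply: le_ereal_inf_tmp => _ [a [b [gam [ab pw ga gb ->]]]].
rewrite leeBlDl//.
have [oI C1 sp] := @segment_C1 c (ball x r) a z (z - y) ac (ball_open _ _) bc.
have lin t : t \in `[a - 1, a] -> ball x r (line a z (z - y) t).
  rewrite in_itv/= => /andP[at0 at1]; rewrite /line.
  have -> : t - a = (t - (a - 1)) - 1 by ring.
  by apply: ball_segment => //; rewrite subr_ge0 at0/=; lra.
pose sig := chart_inv c \o line a z (z - y).
have siga : sig a = gam a by rewrite /sig /line /= subrr scale0r addr0.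
have sig1 : sig (a - 1) = chart_inv c y.
  by rewrite /sig /line /= addrAC subrr add0r scaleN1r opprB subrKC.
pose gam' t := if t <= a then sig t else gam t.
apply: (le_trans _ (@curve_length_prepend _ _ _ g gam sig a b B ab _)); last first.
  move=> t /subset_itv_co_cc/lin tb; rewrite sp//.
  by rewrite -(ger0_norm B0) -sqrtr_sqr ler_wsqrtr// qB.
have -> : chart_inv c y = gam' (a - 1).
  by rewrite /gam' lerBlDr lerDl ler01 sig1.
have ab1 : a - 1 <= b by lra.
apply: riem_dist_set_le_length => //.
  exact: piecewise_C1_prepend oI lin C1 siga pw.
(* If [b = a], the end point lies on the branch of [sig], which takes the value [gam a] there. *)
rewrite /gam'; case: ifPn => [ba|_]; last by rewrite gb.
have eab : b = a by apply/eqP; rewrite eq_le ba ab.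
by rewrite eab siga -eab gb.
Qed.

End Segments.

(** * Estimates for quadratic forms *)

Section QuadBound.
Context (R : realType) (n : nat).
Implicit Types (G H : 'M[R]_n) (u : 'rV[R]_n).

Lemma mx_entry_le_norm p q (A : 'M[R]_(p, q)) i j : `|A i j| <= `|A|.
Proof.
by rewrite [leRHS]/Num.Def.normr/= mx_normrE; exact: (le_bigmax _ _ (i, j)).
Qed.

(** The norm of a matrix is its largest entry in absolute value; the factor [n * n] counts the terms
    of the double sum. *)
Lemma quad_le_norm G u : `|quad G u| <= (n * n)%:R * `|G| * `|u| ^+ 2.
Proof.
rewrite quadE; apply: (le_trans (ler_norm_sum _ _ _)).
apply: (@le_trans _ _ (\sum_(i < n) \sum_(j < n) `|G| * `|u| ^+ 2)).
  apply: ler_sum => i _; apply: (le_trans (ler_norm_sum _ _ _)).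
  apply: ler_sum => j _; rewrite !normrM mulrCA expr2.
  apply: ler_pM => //; first exact: mx_entry_le_norm.
  by apply: ler_pM => //; exact: mx_entry_le_norm.
by rewrite !sumr_const card_ord -mulrnA -[leLHS]mulr_natl mulrA.
Qed.

Lemma quadB G H u : quad (G - H) u = quad G u - quad H u.
Proof. by rewrite /quad mulmxBr mulmxBl !mxE. Qed.

Lemma quadZ G (k : R) u : quad G (k *: u) = k ^+ 2 * quad G u.
Proof.
by rewrite /quad linearZ /= -scalemxAl -scalemxAr -scalemxAl scalerA mxE.
Qed.

Lemma quad_sub G u v : G^T = G ->
  quad G (u - v) = quad G u + quad G v - 2 * (u *m G *m v^T) 0 0.
Proof.
move=> Gs; have vu : (v *m G *m u^T) 0 0 = (u *m G *m v^T) 0 0.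
  have -> : v *m G *m u^T = (u *m G *m v^T)^T by rewrite !trmx_mul trmxK Gs mulmxA.
  by rewrite mxE.
rewrite /quad linearB /= mulmxBr !mulmxBl.
move: vu; move: (u *m G *m u^T) (v *m G *m u^T) (u *m G *m v^T) (v *m G *m v^T).
move=> a b c d vu.
by rewrite !mxE vu; ring.
Qed.

Lemma quad_continuous G : continuous (quad G).
Proof.
move=> u; apply: differentiable_continuous.
pose h i j : 'rV[R]_n -> R := (fun v => v 0 i) * (cst (G i j) * (fun v => v 0 j)).
have -> : quad G = \sum_i \sum_j h i j.
  apply/funext => v; rewrite quadE fct_sumE; apply: eq_bigr => i _.
  by rewrite fct_sumE.
have dh i j : differentiable (h i j) u.
  apply: differentiableM; first exact: differentiable_coord.
  apply: differentiableM; first exact: differentiable_cst.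
  exact: differentiable_coord.
exact: (differentiable_sum (fun i => differentiable_sum (dh i))).
Qed.

End QuadBound.

(** * Local bounds for the metric and for the distance *)

Section LocalDistance.
Context (R : realType) (n : nat) (M : manifold R n) (g : riemannian_metric M).
Implicit Types (c : chart R n M) (x : M) (A : set M).

Lemma local_metric_continuous c x : atlas c -> chart_dom c x ->
  {for c x, continuous (local_metric g c)}.
Proof.
by move=> ac cx; apply: (metric_smooth g ac 0); exists x.
Qed.

Lemma quad_local_metric_near c x (e : R) : atlas c -> chart_dom c x -> 0 < e ->
  exists2 r, 0 < r & ball (c x) r `<=` c @` chart_dom c /\
    forall w, ball (c x) r w -> forall u,
      quad (local_metric g c w) u <=
      quad (local_metric g c (c x)) u + e * `|u| ^+ 2.
Proof.
move=> ac cx e0.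
(* The successor keeps the denominator nonzero in dimension 0 and dominates the factor [n * n] of
   [quad_le_norm]. *)
have e'0 : 0 < e / (n * n).+1%:R by rewrite divr_gt0.
have /cvgrPdist_lt/(_ _ e'0) nG := local_metric_continuous ac cx.
have nc := chart_img_nbhs cx.
have /nbhs_ballP[r r0 br] : nbhs (c x) ((c @` chart_dom c) `&`
   [set w | `|local_metric g c (c x) - local_metric g c w| < e / (n * n).+1%:R]).
  exact: filterI.
exists r => //; split; first by move=> w /br[].
move=> w /br[_ /= ew] u; rewrite -lerBlDl -quadB.
apply: (le_trans (ler_norm _)); apply: (le_trans (quad_le_norm _ _)).
apply: ler_wpM2r; first exact: exprn_ge0.
rewrite distrC in ew.
apply: (@le_trans _ _ ((n * n).+1%:R * (e / (n * n).+1%:R))).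
  by apply: ler_pM => //; [rewrite ler_nat|exact: ltW].
by rewrite mulrC divfK.
Qed.

Lemma riem_dist_set_lipschitz c x A : atlas c -> chart_dom c x ->
  exists r K, [/\ 0 < r, ball (c x) r `<=` c @` chart_dom c, 0 <= K &
    forall y z, ball (c x) r y -> ball (c x) r z ->
    (riem_dist_set g (chart_inv c y) A <=
      (K * `|z - y|)%:E + riem_dist_set g (chart_inv c z) A)%E].
Proof.
move=> ac cx; have [r r0 [rc rG]] := quad_local_metric_near ac cx ltr01.
(* The summand 1 is the slack in [rG]. It also gives [K <= K ^+ 2], so that [K] itself serves as the
   speed bound in place of its square root. *)
pose K := (n * n)%:R * `|local_metric g c (c x)| + 1.
have K1 : 1 <= K by rewrite lerDr mulr_ge0.
have K0 : 0 <= K := le_trans ler01 K1.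
exists r, K; split => // y z ry rz.
apply: (riem_dist_set_segment (x := c x) (r := r)) => //; first exact: mulr_ge0.
move=> w /rG/(_ (z - y))/le_trans; apply.
rewrite exprMn; apply: (@le_trans _ _ (K * `|z - y| ^+ 2)).
  rewrite mulrDl mul1r lerD2r; apply: (le_trans (ler_norm _)).
  exact: quad_le_norm.
by apply: ler_wpM2r; [exact: exprn_ge0|rewrite expr2 ler_peMl].
Qed.

Lemma geodesic01_speed x (eta : tangent x) (gam : R -> M) :
  geodesic01 g eta gam ->
  forall t, 0 <= t <= 1 -> speed g gam t = Num.sqrt (quad (g x) eta).
Proof.
move=> [[I [oI I01 geo]] g0 deta] t /(geodesic_speed_cst oI I01 geo) ->.
subst x.
by rewrite -deta.
Qed.

(** The rest of the geodesic, run at constant speed, is a competitor. *)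
Lemma geodesic01_dist_le x (eta : tangent x) (gam : R -> M) A :
  geodesic01 g eta gam -> A (gam 1) -> forall t, 0 <= t <= 1 ->
  (riem_dist_set g (gam t) A <=
    ((1 - t) * Num.sqrt (quad (g x) eta))%:E)%E.
Proof.
move=> geo A1 t /andP[t0 t1].
have spd := geodesic01_speed geo.
case: geo => -[I [oI I01 geo]] _ _.
rewrite -(@curve_length_cst _ _ _ g gam)//; last first.
  by move=> s; rewrite in_itv/= => /andP[ts s1]; rewrite spd// s1 (le_trans t0).
apply: riem_dist_set_le_length => //.
apply: (C1_curve_piecewise oI _ (geodesic_C1 geo)) => // s.
rewrite /= in_itv/= => /andP[ts s1]; apply: I01.
by rewrite /= in_itv/= s1 (le_trans t0).
Qed.

End LocalDistance.

(** * The one-sided estimate *)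

(* At a minimum of [phi] minus its secant both one-sided bounds apply, and they
   force the slope of the secant to vanish. *)
Lemma dini_le0_endpoints (R : realType) (phi : R -> R) :
  (forall t, 0 <= t <= 1 -> {for t, continuous phi}) ->
  (forall t (e : R), 0 <= t <= 1 -> 0 < e ->
    \forall s \near 0^'+, phi (t + s) <= phi t + e * s) ->
  (forall t (e : R), 0 <= t <= 1 -> 0 < e ->
    \forall s \near 0^'+, phi (t - s) <= phi t + e * s) ->
  phi 0 = phi 1.
Proof.
move=> phic phiR phiL; pose k := phi 1 - phi 0.
pose psi t := phi t - k * t.
have psic : {within `[0, 1], continuous psi}.
  apply: continuous_in_subspaceT => t /set_mem; rewrite /= in_itv/= => t01.
  apply: continuousB; first exact: phic.
  by apply: continuousM; [exact: cst_continuous|exact: cvg_id].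
have [m m01 mmin] := EVT_min ler01 psic.
have min01 t : 0 <= t <= 1 -> psi m <= psi t.
  by move=> t01; apply: mmin; rewrite in_itv.
(* To the right of a minimum [p] of [psi], [phi] grows by at least [k * s], but by at most [e * s]
   by hypothesis; [e] is arbitrary. [kL] is the mirror image. *)
have kR p : 0 <= p < 1 -> (forall t, 0 <= t <= 1 -> psi p <= psi t) -> k <= 0.
  move=> /andP[p0 p1] pmin; apply/ler_addgt0Pl => e e0; rewrite addr0.
  have p01 : 0 <= p <= 1 by rewrite p0 ltW.
  have nR := phiR p e p01 e0.
  near (0 : R)^'+ => s.
  have s0 : 0 < s by near: s; exact: nbhs_right_gt.
  have ps1 : p + s <= 1.
    by rewrite -lerBrDl; near: s; apply: nbhs_right_le; rewrite subr_gt0.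
  have phis : phi (p + s) <= phi p + e * s by near: s.
  have /pmin : 0 <= p + s <= 1 by rewrite ps1 andbT addr_ge0// ltW.
  rewrite /psi => h; rewrite -(ler_pM2r s0); lra.
have kL p : 0 < p <= 1 -> (forall t, 0 <= t <= 1 -> psi p <= psi t) -> 0 <= k.
  move=> /andP[p0 p1] pmin; rewrite -oppr_le0.
  apply/ler_addgt0Pl => e e0; rewrite addr0.
  have p01 : 0 <= p <= 1 by rewrite p1 ltW.
  have nL := phiL p e p01 e0.
  near (0 : R)^'+ => s.
  have s0 : 0 < s by near: s; exact: nbhs_right_gt.
  have ps1 : s <= p by near: s; apply: nbhs_right_le.
  have phis : phi (p - s) <= phi p + e * s by near: s.
  have /pmin : 0 <= p - s <= 1 by lra.
  rewrite /psi => h; rewrite -(ler_pM2r s0); lra.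
have psi01 : psi 0 = psi 1 by rewrite /psi /k; ring.
apply/eqP; rewrite eq_sym -subr_eq0 -/k eq_le.
move: m01; rewrite in_itv/= => /andP[m0 m1].
(* A minimum at one end point is also attained at the other, as [psi 0 = psi 1]; the second end
   point supplies the missing side. *)
have [e0|mn0] := eqVneq m 0.
  rewrite e0 in min01; apply/andP; split.
    by apply: (kR 0); rewrite ?lexx ?ltr01.
  by apply: (kL 1); rewrite ?ltr01 ?lexx// => t /min01; rewrite psi01.
have mp : 0 < m by rewrite lt_neqAle eq_sym mn0.
have [e1|mn1] := eqVneq m 1.
  rewrite e1 -psi01 in min01; apply/andP; split.
    by apply: (kR 0); rewrite ?lexx ?ltr01.
  by apply: (kL 1); rewrite ?ltr01 ?lexx// -psi01.
have ml1 : m < 1 by rewrite lt_neqAle mn1.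
by apply/andP; split; [apply: (kR m)|apply: (kL m)]; rewrite // ?m0 ?m1 ?mp.
Unshelve. all: by end_near. Qed.

Lemma derivable_cvg_right (R : realType) (V : normedModType R) (h : R -> V) :
  derivable h 0 1 -> (s^-1 *: (h s - h 0) @[s --> 0^'+]) --> derive1 h 0.
Proof.
move=> dh; rewrite derive1E.
have cv : (fun s => s^-1 *: ((h \o shift 0) (s *: 1) - h 0)) @ 0^' --> 'D_1 h 0.
  exact: dh.
have -> : (fun s => s^-1 *: (h s - h 0)) =
    (fun s => s^-1 *: ((h \o shift 0) (s *: 1) - h 0)).
  by apply/funext => s /=; rewrite addr0 [_%:A]mulr1.
exact: cvg_dnbhs_at_right.
Qed.

Section FirstVariation.
Context (R : realType) (n : nat) (M : manifold R n) (g : riemannian_metric M).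

(** Cutting the corner saves the arc of length [K * l * s] and costs a segment of length about [s]
    times the square root of [K^2 l^2 + |u|^2]. The difference is O(s / K), which a large [K] brings
    below [e * s]. *)
Lemma riem_dist_set_dini (x : M) (eta : tangent x) (gam om : R -> M)
    (A : set M) (u : 'rV[R]_n) (e : R) :
  geodesic01 g eta gam -> A (gam 1) ->
  curve_length g gam 0 1 = riem_dist_set g x A ->
  (0 < riem_dist_set g x A)%E ->
  om 0 = x -> {for 0, continuous om} ->
  derivable (chart_at x \o om) 0 1 -> derive1 (chart_at x \o om) 0 = u ->
  inner g eta u = 0 -> 0 < e ->
  \forall s \near 0^'+,
    (riem_dist_set g (om s) A <= riem_dist_set g x A + (e * s)%:E)%E.
Proof.
move=> geo A1 len D0 om0 omc dom ou orth e0.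
set c := chart_at x; have ac : atlas c := chart_at_atlas x.
have cx : chart_dom c x := chart_at_dom x.
set l := Num.sqrt (quad (g x) eta).
have DE : riem_dist_set g x A = l%:E.
  rewrite -len (@curve_length_cst _ _ _ g gam 0 1 l)//; first by rewrite subr0 mul1r.
  by move=> t; rewrite in_itv/=; exact: geodesic01_speed.
have l0 : 0 < l by move: D0; rewrite DE lte_fin.
have l2 : quad (g x) eta = l ^+ 2 by rewrite sqr_sqrtr// quad_metric_ge0.
have qu0 : 0 <= quad (g x) u := quad_metric_ge0 g x u.
(* The coordinate segment from [om s] to [gam (K * s)] has squared length
   [s ^ 2 * (K ^ 2 * l ^ 2 + |u| ^ 2 + o(1))], and for this [K] it is shorter
   than [s * (K * l + e)]. *)
pose K := (quad (g x) u + 2) / (2 * l * e).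
have K0 : 0 < K by rewrite divr_gt0 ?mulr_gt0// ltr_wpDl.
(* The left side is the cross term of [(K * l + e) ^+ 2]. The 2 on the right absorbs two errors of
   size 1: the variation of the metric ([rG]) and the convergence of the difference quotients
   ([nq]). *)
have KE : 2 * l * K * e = quad (g x) u + 2.
  by rewrite /K; field; rewrite !gt_eqF.
pose xi : 'rV[R]_n := K *: eta - u.
(* Pythagoras: the cross term vanishes by orthogonality. *)
have qxi : quad (g x) xi = (K * l) ^+ 2 + quad (g x) u.
  rewrite quad_sub; last exact: Defs.metric_sym.
  rewrite quadZ l2 -!scalemxAl [X in _ - _ * X]mxE.
  move: orth; rewrite /inner => ->; ring.
(* The difference quotients tend to [xi], so their norms are eventually at most [rho]; the weight
   [rho ^- 2] then keeps the error of the metric below 1. *)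
pose rho := `|xi| + 1.
have rho0 : 0 < rho by rewrite ltr_wpDl.
have [r r0 [rc rG]] : exists2 r, 0 < r & ball (c x) r `<=` c @` chart_dom c /\
    forall w, ball (c x) r w -> forall v,
      quad (local_metric g c w) v <= quad (g x) v + (rho ^-2) * `|v| ^+ 2.
  have [|r r0 [rc rG]] := @quad_local_metric_near _ _ _ g c x (rho ^- 2) ac cx.
    by rewrite invr_gt0 exprn_gt0.
  by exists r => //; split => // w /rG; rewrite local_metric_chart_at.
have [I [oI I01 gI]] := (let: And3 a _ _ := geo in a).
have g0 : gam 0 = x by case: geo.
have deta : derive1 (c \o gam) 0 = eta by case: geo.
have I0 : I 0 by apply: I01; rewrite /= in_itv/= lexx ler01.
have [gamc dgam] : {for 0, continuous gam} /\ derivable (c \o gam) 0 1.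
  have [gamc /(_ c ac)] := gI 0 I0; rewrite g0 => /(_ cx)[dg _ _].
  by split.
pose gK s := gam (K * s).
have gKc : {for 0, continuous gK}.
  apply: (@continuous_comp _ _ _ (fun s => K * s) gam); last by rewrite mulr0.
  by apply: continuousM; [exact: cst_continuous|exact: cvg_id].
have [dgK egK] : derivable (c \o gK) 0 1 /\ derive1 (c \o gK) 0 = K *: eta.
  have dK : is_derive (0 : R) 1 (fun s : R => K * s) K.
    by apply: is_derive_eq; rewrite [LHS]mulr1.
  have dh : differentiable (c \o gam) (K * 0).
    by rewrite mulr0; exact/derivable1_diffP.
  have [d ->] := derive1_comp_vec (@ex_derive _ _ _ _ _ _ _ dK) dh; split => //.
  rewrite derive1E derive_val deriveE// -[X in 'd _ _ X]mulr1.
  rewrite [LHS]linearZ -deriveE// mulr0 -derive1E deta.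
  by [].
have cvxi : s^-1 *: (c (gK s) - c (om s)) @[s --> 0^'+] --> xi.
  have dd := derivableB dgK dom.
  have ed : derive1 ((c \o gK) - (c \o om)) 0 = xi.
    by rewrite derive1E (deriveB dgK dom) -derive1E egK -derive1E ou.
  have := derivable_cvg_right dd; rewrite ed.
  have -> : ((c \o gK) - (c \o om)) 0 = 0.
    by rewrite -[LHS]/(c (gK 0) - c (om 0)) /gK mulr0 g0 om0 subrr.
  by under eq_fun do rewrite subr0.
have ncom : \forall s \near 0^'+, chart_dom c (om s).
  apply: cvg_within; apply: omc.
  by rewrite om0; exact: chart_dom_nbhs.
have ncgK : \forall s \near 0^'+, chart_dom c (gK s).
  apply: cvg_within; apply: gKc.
  by rewrite /gK mulr0 g0; exact: chart_dom_nbhs.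
have nbom : \forall s \near 0^'+, ball (c x) r (c (om s)).
  apply: cvg_within.
  have ctom := differentiable_continuous ((derivable1_diffP _ _).1 dom).
  by apply: ctom; rewrite /= om0; exact: nbhsx_ballx.
have nbgK : \forall s \near 0^'+, ball (c x) r (c (gK s)).
  apply: cvg_within.
  have ctgK := differentiable_continuous ((derivable1_diffP _ _).1 dgK).
  by apply: ctgK; rewrite /= /gK mulr0 g0; exact: nbhsx_ballx.
have nrho : \forall s \near 0^'+, `|s^-1 *: (c (gK s) - c (om s))| <= rho.
  by apply: (cvgr_norm_le _ cvxi); rewrite /rho ltrDl.
have nq : \forall s \near 0^'+,
    quad (g x) (s^-1 *: (c (gK s) - c (om s))) <= quad (g x) xi + 1.
  have := cvg_comp _ _ cvxi (@quad_continuous _ _ (g x) xi).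
  by move=> /cvgr_le; apply; rewrite ltrDl.
have ns0 : \forall s \near 0^'+, (0 : R) < s by exact: nbhs_right_gt.
(* This keeps the parameter [K * s] within the interval of the geodesic. *)
have nK : \forall s \near 0^'+, s <= K^-1.
  by apply: nbhs_right_le; rewrite invr_gt0.
apply: filterS (filterI ncom (filterI ncgK (filterI nbom (filterI nbgK
  (filterI nrho (filterI nq (filterI ns0 nK))))))).
move=> s [coms [cgs [bo [bg [n1 [q1 [s0 sK]]]]]]].
have Ks1 : K * s <= 1 by rewrite mulrC -ler_pdivlMr// mul1r.
have Ks01 : 0 <= K * s <= 1 by rewrite Ks1 mulr_ge0// ltW.
rewrite -(chart_funK coms).
have B0 : 0 <= s * (K * l + e) by rewrite ltW// mulr_gt0// addr_gt0// mulr_gt0.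
apply: (le_trans (riem_dist_set_segment A ac rc bo bg B0 _)).
  move=> w bw; apply: (le_trans (rG w bw _)).
  set v := c (gK s) - c (om s) in q1 n1 *.
  have vE : v = s *: (s^-1 *: v) by rewrite scalerA mulfV ?scale1r ?gt_eqF.
  rewrite vE quadZ normrZ gtr0_norm// !exprMn mulrCA -mulrDr.
  apply: ler_wpM2l; first exact: exprn_ge0 (ltW s0).
  have n2 : rho ^- 2 * `|s^-1 *: v| ^+ 2 <= 1.
    rewrite mulrC ler_pdivrMr ?exprn_gt0// mul1r.
    by rewrite lerXn2r ?nnegrE// ltW.
  apply: (le_trans (lerD q1 n2)); rewrite qxi.
  rewrite [leRHS]sqrrD.
  have := sqr_ge0 e; nra.
rewrite chart_funK//.
(* The remaining arc has length [(1 - K * s) * l]; added to [s * (K * l + e)] it gives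
   [l + e * s]. *)
apply: (le_trans (leeD2l _ (geodesic01_dist_le geo A1 Ks01))).
rewrite DE -/l -!EFinD lee_fin; lra.
Qed.

End FirstVariation.

(** * Constancy of the distance *)

(** Continuity of the distance to [A], written without subtraction because the distance may be
    infinite. *)
Lemma riem_dist_set_near (R : realType) (n : nat) (M : manifold R n)
    (g : riemannian_metric M) (A : set M) (x : M) (e : R) : 0 < e ->
  \forall y \near x,
    (riem_dist_set g x A <= e%:E + riem_dist_set g y A)%E /\
    (riem_dist_set g y A <= e%:E + riem_dist_set g x A)%E.
Proof.
move=> e0; set c := chart_at x.
have ac : atlas c := chart_at_atlas x.
have cx : chart_dom c x := chart_at_dom x.
have [r [K [r0 _ K0 lip]]] := riem_dist_set_lipschitz g A ac cx.
have d0 : 0 < Num.min r (e / (K + 1)).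
  by rewrite lt_min r0 divr_gt0// ltr_wpDl.
have nc : \forall y \near x, chart_dom c y := chart_dom_nbhs cx.
have nb : \forall y \near x, ball (c x) (Num.min r (e / (K + 1))) (c y).
  by apply: (chart_fun_continuous cx); exact: nbhsx_ballx.
apply: filterS (filterI nc nb) => y [cy].
rewrite -ball_normE /= lt_min => /andP[yr ye].
have br : ball (c x) r (c y) by rewrite -ball_normE.
have bx : ball (c x) r (c x) by exact: ballxx.
have Ke : K * `|c x - c y| <= e.
  have Kp : 0 < K + 1 by rewrite ltr_wpDl.
  move: ye; rewrite ltr_pdivlMr// => ye.
  apply: le_trans (ltW ye); rewrite mulrC.
  by apply: ler_wpM2l => //; rewrite lerDl.
have := lip _ _ bx br; have := lip _ _ br bx; rewrite !chart_funK// distrC.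
by move=> h1 h2; split; [apply: le_trans h2 _|apply: le_trans h1 _];
  rewrite leeD2r// lee_fin// distrC.
Qed.

Section EquidistantImmersion.
Context (R : realType) (m n : nat) (S : manifold R m) (M : manifold R n).
Context (g : riemannian_metric M) (f : S -> M) (A : set M).
Hypothesis hf : differentiable_immersion f.
Hypothesis hA : forall (p : S) (v : tangent p),
  exists (eta : tangent (f p)) (gam : R -> M),
    [/\ inner g eta (mdiff f v) = 0, geodesic01 g eta gam, A (gam 1) &
        curve_length g gam 0 1 = riem_dist_set g (f p) A].

Let h (p : S) : R := fine (riem_dist_set g (f p) A).

(** The distance is finite, being the length of a geodesic of constant speed on [[0, 1]]; the
    hypothesis at [v = 0] provides one. *)
Let hE p : riem_dist_set g (f p) A = (h p)%:E.
Proof.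
have [eta [gam [_ geo _ len]]] := hA (0 : tangent p).
rewrite /h -len.
rewrite (@curve_length_cst _ _ _ g gam 0 1 (Num.sqrt (quad (g (f p)) eta)))//.
by move=> t; rewrite in_itv/=; exact: geodesic01_speed.
Qed.

Let h_ge0 p : 0 <= h p.
Proof. by rewrite -lee_fin -hE riem_dist_set_ge0. Qed.

Let h_continuous : continuous h.
Proof.
move=> p; apply/cvgrPdist_le => e e0.
have [[fc _] _] := hf p.
have nf : \forall q \near p,
    (riem_dist_set g (f p) A <= e%:E + riem_dist_set g (f q) A)%E /\
    (riem_dist_set g (f q) A <= e%:E + riem_dist_set g (f p) A)%E :=
  fc _ (riem_dist_set_near g A (f p) e0).
apply: filterS nf => q []; rewrite !hE -!EFinD !lee_fin => h1 h2.
by rewrite ler_norml; apply/andP; split; lra.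
Qed.

(** The chart [k] stays fixed along a coordinate line, while tangent vectors at [p] are named in
    [chart_at p]. The transition map [T] turns the direction [v] into [v'], and the chain rule at
    the parameter 0 gives the velocity of the image curve. *)
Let h_dini (k : chart R m S) (y v : 'rV[R]_m) (e : R) : atlas k ->
  (k @` chart_dom k) y -> 0 < h (chart_inv k y) -> 0 < e ->
  \forall s \near 0^'+,
    h (chart_inv k (y + s *: v)) <= h (chart_inv k y) + e * s.
Proof.
move=> ak ky hp e0; set p := chart_inv k y.
have kp : chart_dom k p by exact: chart_inv_dom.
have kpE : k p = y by exact: chart_invK.
pose T := chart_at p \o chart_inv k.
have dT : differentiable T y.
  rewrite -kpE; apply: transition_differentiable => //.
    exact: chart_at_atlas.
  exact: chart_at_dom.
pose v' : tangent p := 'D_v T y.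
have [[fc dloc] _] := hf p.
have [eta [gam [orth geo A1 len]]] := hA v'.
pose om s := f (chart_inv k (line 0 y v s)).
have l0 : line 0 y v 0 = y by rewrite /line subrr scale0r addr0.
have om0 : om 0 = f p by rewrite /om l0.
have lc : {for 0, continuous (line 0 y v)} by exact: line_continuous.
have klc : {for 0, continuous (chart_inv k \o line 0 y v)}.
  apply: continuous_comp; first exact: lc.
  by rewrite l0; exact: chart_inv_continuous.
have omc : {for 0, continuous om}.
  apply: (@continuous_comp _ _ _ (chart_inv k \o line 0 y v) f); first exact: klc.
  by rewrite /= l0.
have [dl el] := is_derive_line 0 y v 0.
have [d1 e1] : derivable (T \o line 0 y v) 0 1 /\
    derive1 (T \o line 0 y v) 0 = v'.
  have dT0 : differentiable T (line 0 y v 0) by rewrite l0.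
  have [d ->] := derive1_comp_vec dl dT0; split; first exact: d.
  by rewrite derive1E el l0.
have Tl0 : (T \o line 0 y v) 0 = chart_at p p by rewrite /T /= l0.
have [d2 e2] : derivable (local_expr f p \o (T \o line 0 y v)) 0 1 /\
    derive1 (local_expr f p \o (T \o line 0 y v)) 0 = mdiff f v'.
  have dloc0 : differentiable (local_expr f p) ((T \o line 0 y v) 0).
    by rewrite Tl0.
  have [d ->] := derive1_comp_vec d1 dloc0; split; first exact: d.
  by rewrite e1 Tl0 deriveE.
have eqom : \forall s \near 0, (local_expr f p \o (T \o line 0 y v)) s =
    (chart_at (f p) \o om) s.
  have np : \forall s \near 0, chart_dom (chart_at p) ((chart_inv k \o line 0 y v) s).
    by apply: klc; rewrite /= l0; apply: chart_dom_nbhs; exact: chart_at_dom.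
  apply: filterS np => s ps.
  by rewrite /local_expr /T /= chart_funK.
have [d3 e3] := near_eq_derive1 eqom d2.
have D0 : (0 < riem_dist_set g (f p) A)%E by rewrite hE lte_fin.
have := riem_dist_set_dini geo A1 len D0 om0 omc d3 (etrans e3 e2) orth e0.
apply: filterS => s; rewrite /om !hE -EFinD lee_fin /line subr0.
by [].
Qed.

(** In a coordinate ball where [h] is positive, [q] is joined to [p] by a coordinate segment.
    [h_dini] along [v] and along [- v] gives the two one-sided bounds for [dini_le0_endpoints]. *)
Let h_locally_cst p : 0 < h p -> \forall q \near p, h q = h p.
Proof.
move=> hp; set k := chart_at p.
have ak : atlas k := chart_at_atlas p.
have kp : chart_dom k p := chart_at_dom p.
have hkc y : (k @` chart_dom k) y -> {for y, continuous (h \o chart_inv k)}.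
  move=> ky; apply: continuous_comp; first exact: chart_inv_continuous.
  exact: h_continuous.
have nh : \forall y \near k p, 0 < h (chart_inv k y).
  have := hkc _ (ex_intro2 _ _ p kp erefl).
  by move=> /cvgr_gt; apply; rewrite /= chart_funK.
have /nbhs_ballP[r /= r0 br] : nbhs (k p) ((k @` chart_dom k) `&`
    [set y | 0 < h (chart_inv k y)]) by apply: filterI nh; exact: chart_img_nbhs.
have nb : \forall q \near p, ball (k p) r (k q).
  by apply: (chart_fun_continuous kp); exact: nbhsx_ballx.
apply: filterS (filterI nb (chart_dom_nbhs kp)) => q [bq kq].
pose v := k q - k p.
pose phi (t : R) := h (chart_inv k (k p + t *: v)).
have lb t : 0 <= t <= 1 -> ball (k p) r (k p + t *: v).
  move=> t01; have := ball_segment (ballxx (k p) r0) bq t01.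
  suff -> : k q + (t - 1) *: (k q - k p) = k p + t *: v by [].
  by rewrite scalerBl scale1r opprB addrCA addrC subrKC.
have phi0 : phi 0 = h p by rewrite /phi scale0r addr0 chart_funK.
have phi1 : phi 1 = h q by rewrite /phi scale1r /v subrKC chart_funK.
rewrite -phi0 -phi1; apply/esym/dini_le0_endpoints => t.
- move=> /lb/br[kt _].
  have -> : phi = (h \o chart_inv k) \o line 0 (k p) v.
    by apply/funext => s; rewrite /phi /= /line subr0.
  apply: continuous_comp; first exact: line_continuous.
  by apply: hkc; rewrite /line subr0.
- move=> e /lb/br[kt ht] e0.
  have := h_dini v ak kt ht e0; apply: filterS => s.
  by rewrite -addrA -scalerDl.
- move=> e /lb/br[kt ht] e0.
  have := h_dini (- v) ak kt ht e0; apply: filterS => s.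
  by rewrite -addrA scalerN -scalerBl.
Qed.

Lemma equidistant_of_orthogonal_minimizers : connected [set: S] ->
  exists r : R, 0 <= r /\ range f `<=` equidistant_set g A r.
Proof.
move=> hS.
suff [r [r0 hr]] : exists r, 0 <= r /\ forall p, h p = r.
  exists r; split => // _ [p _ <-].
  by rewrite /equidistant_set /= hE hr.
have [[p hp]|hn] := pselect (exists p, 0 < h p); last first.
  exists 0; split => // p; apply/eqP; rewrite eq_le h_ge0 andbT leNgt.
  by apply/negP => hp; apply: hn; exists p.
exists (h p); split; first exact: h_ge0.
suff BT : [set q | h q = h p] = [set: S].
  by move=> q; have : [set: S] q by []; rewrite -BT.
apply: hS; first by exists p.
- exists [set q | h q = h p]; last by rewrite setTI.
  rewrite openE => q /= hq; rewrite /interior.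
  have : 0 < h q by rewrite hq.
  by move=> /h_locally_cst; apply: filterS => q' /= ->.
- exists [set q | h q = h p]; last by rewrite setTI.
  have -> : [set q | h q = h p] = h @^-1` [set h p] by [].
  apply: closed_comp; last exact: closed_eq.
  by move=> q _; exact: h_continuous.
Qed.

End EquidistantImmersion.

Unset Implicit Arguments.

Theorem corollary1 (R : realType) (m n : nat)
    (S : manifold R m) (M : manifold R n) (g : riemannian_metric M)
    (f : S -> M) (A : set M)
    (hS : connected [set: S])
    (hf : differentiable_immersion f)
    (hA : forall (p : S) (v : tangent p),
      exists (eta : tangent (f p)) (gam : R -> M),
        [/\ inner g eta (mdiff f v) = 0,
            geodesic01 g eta gam,
            A (gam 1) &
            curve_length g gam 0 1 = riem_dist_set g (f p) A]) :
  exists r : R, 0 <= r /\ range f `<=` equidistant_set g A r.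
Proof. exact: equidistant_of_orthogonal_minimizers hf hA hS. Qed.
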